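(* Let $(\mathbf{X},\mathbf{Y})=\{(X^n,Y^n)\}_{n=1}^{\infty}$ be a pair of general sources with finite alphabets $\mathcal{X},\mathcal{Y}$, let $\hat{\mathcal{X}}$ be a finite output alphabet, and let $\{c_n\}_{n=1}^\infty$, $c_n:\mathcal{X}^n\times\hat{\mathcal{X}}^n\to[0,\infty)$, be uniformly bounded cost functions. For any real numbers $\epsilon,R\ge 0$, the minimum average cost $C_{\rm a}(\epsilon,R)$ under the weak independence criterion satisfies $$C_{\rm a}(\epsilon,R)=\inf_{\substack{\hat{\mathbf{X}}:\ \mathbf{Y}-\mathbf{X}-\hat{\mathbf{X}},\\ I(\mathbf{Y};\hat{\mathbf{X}})\le\epsilon,\ \overline{H}(\hat{\mathbf{X}}|\mathbf{X})\le R}} c(\mathbf{X},\hat{\mathbf{X}}),$$ where the infimum is over all sequences $\hat{\mathbf{X}}=\{\hat X^n\}_{n=1}^\infty$ of random variables, $\hat X^n$ taking values in $\hat{\mathcal{X}}^n$ and jointly distributed with $(X^n,Y^n)$, that satisfy the indicated constraints.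
   Context: $\mathcal{X},\mathcal{Y},\hat{\mathcal{X}}$ are finite nonempty sets; $\log$ is the natural logarithm; $I(\cdot;\cdot)$ is mutual information. A pair of general sources $(\mathbf{X},\mathbf{Y})=\{(X^n,Y^n)\}_{n=1}^\infty$ is an arbitrary sequence of pairs of random variables, $(X^n,Y^n)$ taking values in $\mathcal{X}^n\times\mathcal{Y}^n$ (no consistency between different $n$ is required). The cost functions $c_n:\mathcal{X}^n\times\hat{\mathcal{X}}^n\to[0,\infty)$ satisfy $\sup_{n\ge1}\sup_{(x^n,\hat x^n)}c_n(x^n,\hat x^n)<\infty$. For a positive integer $M_n$, $U_{M_n}$ is uniformly distributed on $\mathcal{U}_{M_n}=\{1,\dots,M_n\}$ and independent of $(X^n,Y^n)$. An encoder is a (deterministic) map $f_n:\mathcal{X}^n\times\mathcal{U}_{M_n}\to\hat{\mathcal{X}}^n$. For $R,\Gamma,\epsilon\ge0$, $(R,\Gamma)$ is $\epsilon$-weakly achievable in the sense of the average cost if there exist a sequence of positive integers $\{M_n\}$ and encoders $\{f_n\}$ such that $\limsup_{n\to\infty}\frac1n\log M_n\le R$, $\limsup_{n\to\infty}\frac1n I(Y^n;f_n(X^n,U_{M_n}))\le\epsilon$, and $\limsup_{n\to\infty}\mathrm{E}[c_n(X^n,f_n(X^n,U_{M_n}))]\le\Gamma$. Define $C_{\rm a}(\epsilon,R)=\inf\{\Gamma\ge 0:(R,\Gamma)\text{ is }\epsilon\text{-weakly achievable in the sense of the average cost}\}$. For a sequence of real-valued random variables $Z_n$: $\mathrm{p}\text{-}\limsup_{n\to\infty}Z_n=\inf\{\alpha:\lim_{n\to\infty}\Pr\{Z_n>\alpha\}=0\}$.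 Define $I(\mathbf{Y};\hat{\mathbf{X}})=\limsup_{n\to\infty}\frac1nI(Y^n;\hat X^n)$, $\overline{H}(\hat{\mathbf{X}}|\mathbf{X})=\mathrm{p}\text{-}\limsup_{n\to\infty}\frac1n\log\frac{1}{P_{\hat X^n|X^n}(\hat X^n|X^n)}$, $c(\mathbf{X},\hat{\mathbf{X}})=\limsup_{n\to\infty}\mathrm{E}[c_n(X^n,\hat X^n)]$. The notation $\mathbf{Y}-\mathbf{X}-\hat{\mathbf{X}}$ means that $Y^n-X^n-\hat X^n$ is a Markov chain for every $n\ge1$. *)

(* Defs.v *)
From HB Require Import structures.
From mathcomp Require Export all_boot all_order all_algebra.
From mathcomp Require Export all_classical all_reals all_analysis.
Export Order.TTheory GRing.Theory Num.Theory.
Export numFieldNormedType.Exports.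

Set Implicit Arguments.
Unset Strict Implicit.
Unset Printing Implicit Defensive.

Local Open Scope classical_set_scope.
Local Open Scope ring_scope.

(* All random variables below take finitely many values, so they are modelled
   as functions on a finite probability space (T, p) with p : fdist R T. *)
Record fdist (R : realType) (T : finType) := Fdist {
  pmf :> T -> R ;
  pmf_ge0 : forall t, 0 <= pmf t ;
  pmf_sum1 : \sum_t pmf t = 1 }.

Section Constructions.
Variable R : realType.

Lemma unif_ge0 (M : nat) (i : 'I_M) : 0 <= (M%:R^-1 : R).
Proof. by rewrite invr_ge0. Qed.

Lemma unif_sum1 (M : nat) (hM : (0 < M)%N) : \sum_(i < M) (M%:R^-1 : R) = 1.
Proof.
by rewrite sumr_const card_ord -[LHS]mulr_natr mulVf // pnatr_eq0 -lt0n.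
Qed.

(* The labels 1, ..., M are represented by the elements 0, ..., M - 1 of 'I_M. *)
Definition unif (M : nat) (hM : (0 < M)%N) : fdist R 'I_M :=
  Fdist (@unif_ge0 M) (unif_sum1 hM).

Variables (A B : finType) (p : fdist R A) (q : fdist R B).

Lemma indep_prod_ge0 (w : A * B) : 0 <= p w.1 * q w.2.
Proof. by rewrite mulr_ge0 ?pmf_ge0. Qed.

Lemma indep_prod_sum1 : \sum_(w : A * B) p w.1 * q w.2 = 1.
Proof.
rewrite -(pair_bigA _ (fun a b => p a * q b)) /= -[RHS](pmf_sum1 p).
by apply: eq_bigr => a _; rewrite -mulr_sumr pmf_sum1 mulr1.
Qed.

Definition indep_prod : fdist R (A * B)%type :=
  Fdist indep_prod_ge0 indep_prod_sum1.

End Constructions.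

Section RandomVariables.
Variables (R : realType) (T : finType) (p : fdist R T).

Definition Pr (E : pred T) : R := \sum_(t | E t) p t.

Definition expect (Z : T -> R) : R := \sum_t p t * Z t.

Definition law (A : finType) (U : T -> A) (a : A) : R := Pr [pred t | U t == a].

(* P(U = a | V = b); it is 0 when P(V = b) = 0. *)
Definition cond_law (A B : finType) (U : T -> A) (V : T -> B) (a : A) (b : B) : R :=
  Pr [pred t | (U t == a) && (V t == b)] / law V b.

(* Terms with P(U = a, V = b) = 0 vanish, whatever the value of the logarithm. *)
Definition mutual_info (A B : finType) (U : T -> A) (V : T -> B) : R :=
  \sum_a \sum_b
    law (fun t => (U t, V t)) (a, b) *
      ln (law (fun t => (U t, V t)) (a, b) / (law U a * law V b)).

(* U - V - W: U and W are conditionally independent given V. *)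
Definition markov (A B C : finType) (U : T -> A) (V : T -> B) (W : T -> C) : Prop :=
  forall a b c, law V b != 0 ->
    cond_law (fun t => (U t, W t)) V (a, c) b = cond_law U V a b * cond_law W V c b.

End RandomVariables.

Definition limsup_real (R : realType) (u : nat -> R) : \bar R :=
  limn_esup (fun n => (u n)%:E).

Definition p_limsup (R : realType) (T : nat -> finType)
    (p : forall n, fdist R (T n)) (Z : forall n, T n -> R) : \bar R :=
  ereal_inf [set alpha%:E | alpha in
    [set alpha : R | (fun n => Pr (p n) [pred t | alpha < Z n t]) @ \oo --> (0 : R)]].

(* Sequences (n >= 1) are indexed by k : nat with n = k.+1: the k-th item of
   every sequence below concerns block length k.+1. *)
Section Problem.
Variables (R : realType) (X Y Xhat : finType).

Definition source_pair :=
  forall k, fdist R (k.+1.-tuple X * k.+1.-tuple Y)%type.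

Definition cost_fun := forall k, k.+1.-tuple X -> k.+1.-tuple Xhat -> R.

Variables (XY : source_pair) (c : cost_fun).

Section Coding.
Variables (M : nat -> nat) (hM : forall k, (0 < M k)%N)
  (f : forall k, k.+1.-tuple X -> 'I_(M k) -> k.+1.-tuple Xhat).

Definition code_space k : fdist R ((k.+1.-tuple X * k.+1.-tuple Y) * 'I_(M k))%type :=
  indep_prod (XY k) (unif R (hM k)).

Definition code_rate : \bar R :=
  limsup_real (fun k => k.+1%:R^-1 * ln (M k)%:R).

Definition code_info : \bar R :=
  limsup_real (fun k => k.+1%:R^-1 *
    mutual_info (code_space k) (fun w => w.1.2) (fun w => f w.1.1 w.2)).

Definition code_cost : \bar R :=
  limsup_real (fun k =>
    expect (code_space k) (fun w => c w.1.1 (f w.1.1 w.2))).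

End Coding.

Definition weakly_achievable (eps rate Gamma : R) : Prop :=
  exists (M : nat -> nat) (hM : forall k, (0 < M k)%N)
    (f : forall k, k.+1.-tuple X -> 'I_(M k) -> k.+1.-tuple Xhat),
    [/\ (code_rate M <= rate%:E)%E,
        (code_info hM f <= eps%:E)%E
      & (code_cost hM f <= Gamma%:E)%E].

Definition min_avg_cost (eps rate : R) : \bar R :=
  ereal_inf [set Gamma%:E | Gamma in
    [set Gamma : R | 0 <= Gamma /\ weakly_achievable eps rate Gamma]].

(* The joint laws of ((X^n, Y^n), \hat X^n), n >= 1. *)
Definition joint_output :=
  forall k, fdist R ((k.+1.-tuple X * k.+1.-tuple Y) * k.+1.-tuple Xhat)%type.

Variable Q : joint_output.

Definition output_of : Prop :=
  forall k xy, law (Q k) (fun w => w.1) xy = XY k xy.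

Definition markov_output : Prop :=
  forall k, markov (Q k) (fun w => w.1.2) (fun w => w.1.1) (fun w => w.2).

Definition info_rate : \bar R :=
  limsup_real (fun k => k.+1%:R^-1 *
    mutual_info (Q k) (fun w => w.1.2) (fun w => w.2)).

Definition cond_sup_entropy : \bar R :=
  p_limsup Q (fun k w => k.+1%:R^-1 *
    ln (1 / cond_law (Q k) (fun v => v.2) (fun v => v.1.1) w.2 w.1.1)).

Definition avg_cost : \bar R :=
  limsup_real (fun k => expect (Q k) (fun w => c w.1.1 w.2)).

End Problem.

(* Main.v *)
Require Import Defs.
From mathcomp Require Import ring lra.

(* Converse: a code with M messages induces a channel whose transition
   probabilities are multiples of 1/M, so -log P(xhat | x) <= log M almost
   surely.
   Direct part: round the conditional law W(. | x) down to multiples of 1/M and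
   send the remaining mass to a fixed word; the result is the output of an
   encoder fed with M uniform labels.  The mass theta moved this way is at most
   tau / M plus the probability that W(xhat | x) < 1 / tau, which vanishes for
   log tau = n (R + gamma_n), log M ~ n (R + 2 gamma_n) and gamma_n -> 0 slowly.
   The rounded joint law and the original one share a common part and the same
   marginal of Y^n, so their mutual informations differ by at most
   2 log 2 + theta n log |Y|, which is o(n). *)

Set Implicit Arguments.
Unset Strict Implicit.
Unset Printing Implicit Defensive.

Local Open Scope classical_set_scope.
Local Open Scope ring_scope.

(** * Convexity of [s * ln s] and stability of mutual information *)

Section Entropy.
Variable R : realType.
Implicit Types s t w : R.

(** The graph of [s * ln s] lies above its tangent at [w], by [1 + u <= expR u] at [u = ln (w / s)].
    The upper bounds on entropy below rest on this. *)
Lemma xlnx_tangent s w : 0 <= s -> 0 < w -> s - w <= s * ln s - s * ln w.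
Proof.
rewrite le_eqVlt => /predU1P[<- w0|s0 w0]; first by rewrite !mul0r; lra.
have sw0 : 0 < w / s by rewrite divr_gt0.
have : expR (ln (w / s)) >= 1 + ln (w / s) by exact: expR_ge1Dx.
rewrite lnK // lnM ?posrE ?invr_gt0 // lnV ?posrE // => h.
have : s * (1 + (ln w - ln s)) <= s * (w / s) by rewrite ler_pM2l.
by rewrite [s * (w / s)]mulrC divfK ?gt_eqF //; lra.
Qed.

Lemma xlnx_le s t : 0 <= s -> s <= t -> s * ln s <= s * ln t.
Proof.
rewrite le_eqVlt => /predU1P[<- _|s0 st]; first by rewrite !mul0r.
by rewrite ler_pM2l // ler_ln // posrE (lt_le_trans s0).
Qed.

Lemma xlnx_superadd s t :
  0 <= s -> 0 <= t -> s * ln s + t * ln t <= (s + t) * ln (s + t).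
Proof. by move=> s0 t0; rewrite mulrDl lerD // xlnx_le ?lerDl ?lerDr. Qed.

Lemma ln2_ge0 : 0 <= ln 2 :> R.
Proof. by rewrite ln_ge0 // ler1n. Qed.

(** Splitting a mass in two creates at most [ln 2] of entropy per unit of mass: add the two tangent
    inequalities at the midpoint [(s + t) / 2]. *)
Lemma xlnx_subadd s t : 0 <= s -> 0 <= t ->
  (s + t) * ln (s + t) <= s * ln s + t * ln t + (s + t) * ln 2.
Proof.
move=> s0 t0; have := addr_ge0 s0 t0.
rewrite le_eqVlt => /predU1P[st0|st0].
  have [-> ->] : s = 0 /\ t = 0 by lra.
  by rewrite addr0 !mul0r !addr0.
have w0 : 0 < (s + t) / 2 by rewrite divr_gt0.
have := xlnx_tangent s0 w0; have := xlnx_tangent t0 w0.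
rewrite lnM ?posrE ?invr_gt0 // lnV ?posrE //; lra.
Qed.

Section Joint.
Variables A B : finType.
Implicit Types m g b : B -> A -> R.

Definition xlnx s := s * ln s.

(* [sum m ln (m / m_A)], minus the conditional entropy of [B] given [A]. *)
Definition neg_cond_ent m :=
  \sum_y \sum_a xlnx (m y a) - \sum_a xlnx (\sum_y m y a).

(** This is H(B) - H(B | A). The marginal of [B] is a separate term because the perturbation below
    leaves it fixed. *)
Definition mutual m := neg_cond_ent m - \sum_y xlnx (\sum_a m y a).

Lemma neg_cond_ent_le0 m : (forall y a, 0 <= m y a) -> neg_cond_ent m <= 0.
Proof.
move=> m0; rewrite subr_le0 exchange_big ler_sum // => a _.
rewrite /xlnx mulr_suml ler_sum // => y _; apply: xlnx_le => //.
by rewrite (bigD1 y) //= lerDl sumr_ge0.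
Qed.

(** Conditional entropy is at most [ln #|B|] per unit of mass: in each column [a], use the tangent
    at the column mass spread uniformly over [B]. Columns of mass zero are treated apart, since the
    point of tangency must be positive. *)
Lemma neg_cond_ent_ge m : (0 < #|B|)%N -> (forall y a, 0 <= m y a) ->
  - ((\sum_y \sum_a m y a) * ln #|B|%:R) <= neg_cond_ent m.
Proof.
move=> B0 m0; rewrite /neg_cond_ent exchange_big.
rewrite [X in _ <= X - _]exchange_big /=.
rewrite -sumrB mulr_suml -sumrN ler_sum // => a _.
have B0' : 0 < #|B|%:R :> R by rewrite ltr0n.
have : 0 <= \sum_y m y a by rewrite sumr_ge0.
rewrite le_eqVlt => /predU1P[mA0|mA0].
  have my y : m y a = 0.
    have : \sum_y m y a == 0 by rewrite -mA0.
    by rewrite psumr_eq0 // => /allP/(_ y (mem_index_enum _))/eqP.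
  rewrite -mA0 /xlnx !mul0r oppr0 addr0 sumr_ge0 // => y _.
  by rewrite my mul0r.
have w0 : 0 < (\sum_y m y a) / #|B|%:R by rewrite divr_gt0.
have : \sum_y (m y a - (\sum_y m y a) / #|B|%:R) <=
       \sum_y (m y a * ln (m y a) - m y a * ln ((\sum_y m y a) / #|B|%:R)).
  by apply: ler_sum => y _; exact: xlnx_tangent.
rewrite !sumrB -mulr_suml sumr_const -[_ *+ _]mulr_natr mulfK ?gt_eqF //.
by rewrite subrr lnM ?posrE ?invr_gt0 // lnV ?posrE // -mulr_suml /xlnx; lra.
Qed.

(** The marginals on [B] agree, so H(B) cancels. Conditional entropy is additive over a sum of
    measures up to [ln 2]; this is used once for [g + b'] and once for [g + b]. What remains is the
    entropy of [b'], of favourable sign, and that of [b], bounded by its mass times [ln #|B|]. *)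
Lemma mutual_perturb g b b' : (0 < #|B|)%N ->
    (forall y a, 0 <= g y a) -> (forall y a, 0 <= b y a) ->
    (forall y a, 0 <= b' y a) -> (forall y, \sum_a b y a = \sum_a b' y a) ->
    \sum_y \sum_a (g y a + b y a) = 1 ->
  mutual (fun y a => g y a + b' y a) <=
  mutual (fun y a => g y a + b y a) +
    (2 * ln 2 + (\sum_y \sum_a b y a) * ln #|B|%:R).
Proof.
move=> B0 g0 b0 b'0 bb' gb1.
have gb1' : \sum_y \sum_a (g y a + b' y a) = 1.
  by rewrite -gb1; apply: eq_bigr => y _; rewrite !big_split /= bb'.
have E y : \sum_a (g y a + b' y a) = \sum_a (g y a + b y a).
  by rewrite !big_split /= bb'.
have sumDD (F G : B -> A -> R) : \sum_y \sum_a (F y a + G y a) =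
    \sum_y \sum_a F y a + \sum_y \sum_a G y a.
  by rewrite -big_split; apply: eq_bigr => y _; rewrite big_split.
have sumM (F : B -> A -> R) : \sum_y \sum_a (F y a * ln 2) =
    (\sum_y \sum_a F y a) * ln 2.
  by rewrite mulr_suml; apply: eq_bigr => y _; rewrite mulr_suml.
have up : neg_cond_ent (fun y a => g y a + b' y a) <=
    neg_cond_ent g + neg_cond_ent b' + ln 2.
  have h1 : \sum_y \sum_a xlnx (g y a + b' y a) <=
      \sum_y \sum_a (xlnx (g y a) + xlnx (b' y a) + (g y a + b' y a) * ln 2).
    by apply: ler_sum => y _; apply: ler_sum => a _; exact: xlnx_subadd.
  have h2 : \sum_a (xlnx (\sum_y g y a) + xlnx (\sum_y b' y a)) <=
      \sum_a xlnx (\sum_y (g y a + b' y a)).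
    by apply: ler_sum => a _; rewrite big_split xlnx_superadd ?sumr_ge0.
  move: h1 h2; rewrite !sumDD sumM gb1' mul1r !big_split /= /neg_cond_ent; lra.
have lo : neg_cond_ent g + neg_cond_ent b - ln 2 <=
    neg_cond_ent (fun y a => g y a + b y a).
  have h1 : \sum_y \sum_a (xlnx (g y a) + xlnx (b y a)) <=
      \sum_y \sum_a xlnx (g y a + b y a).
    by apply: ler_sum => y _; apply: ler_sum => a _; exact: xlnx_superadd.
  have h2 : \sum_a xlnx (\sum_y (g y a + b y a)) <=
     \sum_a (xlnx (\sum_y g y a) + xlnx (\sum_y b y a) +
             (\sum_y (g y a + b y a)) * ln 2).
    by apply: ler_sum => a _; rewrite big_split xlnx_subadd ?sumr_ge0.
  move: h1 h2; rewrite sumDD !big_split /= -mulr_suml.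
  rewrite [X in X * ln 2](_ : _ = 1); last first.
    by rewrite -gb1 exchange_big.
  rewrite mul1r /neg_cond_ent; lra.
rewrite /mutual; under [X in _ - X <= _]eq_bigr do rewrite E.
have := neg_cond_ent_le0 b'0; have := neg_cond_ent_ge B0 b0; lra.
Qed.

End Joint.
End Entropy.

(** * Laws and mutual information of finite random variables *)

Section Finite.
Variable R : realType.

Lemma fdist_ext (T : finType) (p q : fdist R T) : p =1 q -> p = q.
Proof.
case: p q => [p p0 p1] [q q0 q1] /= /funext pq; subst q.
by congr Fdist; exact: Prop_irrelevance.
Qed.

Lemma law_ge0 (T A : finType) (p : fdist R T) (U : T -> A) a : 0 <= law p U a.
Proof. by rewrite sumr_ge0 // => t _; rewrite pmf_ge0. Qed.

Lemma expect_law (T A : finType) (p : fdist R T) (U : T -> A) (Z : A -> R) :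
  expect p (Z \o U) = \sum_a law p U a * Z a.
Proof.
rewrite /expect (partition_big U xpredT) //=; apply: eq_bigr => a _.
by rewrite mulr_suml; apply: eq_bigr => t /eqP ->.
Qed.

Lemma Pr_expect (T : finType) (p : fdist R T) (E : pred T) :
  Pr p E = expect p (fun t => (E t)%:R).
Proof.
rewrite /Pr big_mkcond; apply: eq_bigr => t _.
by case: (E t); rewrite ?mulr1 ?mulr0.
Qed.

Lemma law_sum1 (T A : finType) (p : fdist R T) (U : T -> A) :
  \sum_a law p U a = 1.
Proof. by rewrite -(pmf_sum1 p) [RHS](partition_big U xpredT). Qed.

Lemma law_fst (T A B : finType) (p : fdist R T) (U : T -> A) (V : T -> B) a :
  law p U a = \sum_b law p (fun t => (U t, V t)) (a, b).
Proof.
by rewrite /law /Pr (partition_big V xpredT).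
Qed.

Lemma law_snd (T A B : finType) (p : fdist R T) (U : T -> A) (V : T -> B) b :
  law p V b = \sum_a law p (fun t => (U t, V t)) (a, b).
Proof.
rewrite /law /Pr (partition_big U xpredT) //=.
by apply: eq_bigr => a _; apply: eq_bigl => t; rewrite xpair_eqE andbC.
Qed.

(** Terms of zero joint probability vanish on both sides; for the others both marginals are positive
    and the logarithm of the quotient splits. *)
Lemma mutual_infoE (T A B : finType) (p : fdist R T) (U : T -> B) (V : T -> A) :
  mutual_info p U V =
  mutual (fun y a => law p (fun t => (U t, V t)) (y, a)).
Proof.
rewrite /mutual /neg_cond_ent /mutual_info.
set m := law p _.
have m0 w : 0 <= m w by exact: law_ge0.
have -> : \sum_y xlnx (\sum_a m (y, a)) =
    \sum_y \sum_a m (y, a) * ln (law p U y).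
  by apply: eq_bigr => y _; rewrite /xlnx -mulr_suml -law_fst.
have -> : \sum_a xlnx (\sum_y m (y, a)) =
    \sum_y \sum_a m (y, a) * ln (law p V a).
  rewrite exchange_big; apply: eq_bigr => a _.
  by rewrite /xlnx -mulr_suml -law_snd.
rewrite -!sumrB; apply: eq_bigr => y _; rewrite -!sumrB; apply: eq_bigr => a _.
have := m0 (y, a); rewrite le_eqVlt => /predU1P[<-|ma].
  by rewrite /xlnx !mul0r !subr0.
have U0 : 0 < law p U y.
  by rewrite (law_fst _ _ V) (bigD1 a) //= ltr_pwDl // sumr_ge0.
have V0 : 0 < law p V a.
  by rewrite (law_snd _ U) (bigD1 y) //= ltr_pwDl // sumr_ge0.
rewrite lnM ?posrE ?invr_gt0 ?mulr_gt0 // lnV ?posrE ?mulr_gt0 // lnM ?posrE //.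
rewrite /xlnx; lra.
Qed.

End Finite.

(** * Markov outputs as channel outputs, and the channel of a code *)

Section Channel.
Variable R : realType.

Definition pushforward (T A : finType) (p : fdist R T) (U : T -> A) :
    fdist R A :=
  Fdist (law_ge0 p U) (law_sum1 p U).

Section Output.
Variables (S B A : finType) (p : fdist R (S * B)%type).

Section Def.
Variable W : S -> fdist R A.

Lemma channel_out_ge0 (w : S * B * A) : 0 <= p w.1 * W w.1.1 w.2.
Proof. by rewrite mulr_ge0 ?pmf_ge0. Qed.

Lemma channel_out_sum1 : \sum_(w : S * B * A) p w.1 * W w.1.1 w.2 = 1.
Proof.
rewrite -(pair_bigA _ (fun s a => p s * W s.1 a)) /= -[RHS](pmf_sum1 p).
by apply: eq_bigr => s _; rewrite -mulr_sumr pmf_sum1 mulr1.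
Qed.

(** Only the [S] component is fed to the channel, so the Markov condition holds by construction. *)
Definition channel_out : fdist R (S * B * A)%type :=
  Fdist channel_out_ge0 channel_out_sum1.

Lemma channel_out_sum (P : pred (S * B)) :
  \sum_(w | P w.1) channel_out w = \sum_(s | P s) p s.
Proof.
under eq_bigl do rewrite -[P _]andbT.
rewrite -(pair_big P xpredT (fun s a => p s * W s.1 a)) /=.
by apply: eq_bigr => s _; rewrite -mulr_sumr pmf_sum1 mulr1.
Qed.

Lemma law_channel_out_fst s : law channel_out fst s = p s.
Proof. by rewrite /law /Pr (channel_out_sum (pred1 s)) big_pred1_eq. Qed.

Lemma law_channel_out_input x :
  law channel_out (fun w => w.1.1) x = law p fst x.
Proof. exact: (channel_out_sum (fun s => s.1 == x)). Qed.

Lemma Pr_channel_out_input_output x a :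
  Pr channel_out [pred w | (w.2 == a) && (w.1.1 == x)] = law p fst x * W x a.
Proof.
rewrite /Pr; under eq_bigl do rewrite /= andbC.
rewrite -(pair_big (fun s => s.1 == x) (pred1 a) (fun s a => p s * W s.1 a)) /=.
rewrite /law /Pr mulr_suml; apply: eq_bigr => s /eqP <-.
by rewrite big_pred1_eq.
Qed.

(** On the support, conditioning is on a non-null input and the logarithm is that of a positive
    number; the events in the entropy bounds are compared only there. *)
Lemma channel_out_neq0 w :
  channel_out w != 0 -> law p fst w.1.1 != 0 /\ W w.1.1 w.2 != 0.
Proof.
rewrite mulf_eq0 negb_or => /andP[pw Ww]; split => //.
apply: contra_neq pw => /eqP; rewrite psumr_eq0 => [/allP h|*]; last first.
  exact: pmf_ge0.
by have := h w.1 (mem_index_enum _); rewrite /= eqxx => /eqP.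
Qed.

Lemma cond_law_channel_out x a : law p fst x != 0 ->
  cond_law channel_out (fun w => w.2) (fun w => w.1.1) a x = W x a.
Proof.
move=> px; rewrite /cond_law Pr_channel_out_input_output law_channel_out_input.
by rewrite mulrC mulKf.
Qed.

Lemma channel_out_markov :
  markov channel_out (fun w => w.1.2) (fun w => w.1.1) (fun w => w.2).
Proof.
move=> y x a; rewrite law_channel_out_input => px.
rewrite cond_law_channel_out // /cond_law mulrAC; congr (_ / _).
have -> : Pr channel_out [pred w | (w.1.2 == y) && (w.1.1 == x)] = p (x, y).
  rewrite /Pr (channel_out_sum (fun s => (s.2 == y) && (s.1 == x))).
  by rewrite (big_pred1 (x, y)) // => -[x' y'] /=; rewrite xpair_eqE andbC.
rewrite /Pr (big_pred1 ((x, y), a)) // => -[[x' y'] a'] /=.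
by rewrite !xpair_eqE andbAC [(y' == y) && _]andbC.
Qed.

Lemma law_channel_out_pair y a :
  law channel_out (fun w => (w.1.2, w.2)) (y, a) = \sum_x p (x, y) * W x a.
Proof.
rewrite /law /Pr (reindex_onto (fun x => ((x, y), a)) (fun w => w.1.1)) /=.
  by apply: eq_bigl => x; rewrite !eqxx.
by move=> [[x' y'] a'] /eqP[-> ->].
Qed.

End Def.

(** The channel is the conditional law of the output given the input; the Markov condition then
    factors [q]. *)
Lemma markov_channel (q : fdist R (S * B * A)%type) :
    (forall s, law q fst s = p s) ->
    markov q (fun w => w.1.2) (fun w => w.1.1) (fun w => w.2) ->
  exists W, q = channel_out W.
Proof.
move=> qp qM.
have q1 y x a : Pr q [pred w | ((w.1.2, w.2) == (y, a)) && (w.1.1 == x)] =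
    q ((x, y), a).
  rewrite /Pr (big_pred1 ((x, y), a)) // => -[[x' y'] a'] /=.
  by rewrite !xpair_eqE andbAC [(y' == y) && _]andbC.
have q2 y x : Pr q [pred w | (w.1.2 == y) && (w.1.1 == x)] = p (x, y).
  rewrite -qp; apply: eq_bigl => -[[x' y'] a'] /=.
  by rewrite !xpair_eqE andbC.
suff /choice[W qW] : forall x, exists w : fdist R A,
    forall y a, q ((x, y), a) = p (x, y) * w a.
  by exists W; apply: fdist_ext => -[[x y] a]; exact: qW.
move=> x; have [x0|x0] := eqVneq (law q (fun w => w.1.1) x) 0.
  (* A null input does not constrain [W x]: both sides are zero, and the marginal law of the output
     serves as an arbitrary distribution. *)
  exists (pushforward q snd) => y a.
  have q0 y' a' : q ((x, y'), a') = 0.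
    apply/eqP; rewrite eq_le pmf_ge0 andbT -x0 /law /Pr.
    rewrite (bigD1 ((x, y'), a')) /= ?eqxx // lerDl sumr_ge0 // => w _.
    by rewrite pmf_ge0.
  rewrite q0 -qp /law [Pr q _]big1 ?mul0r // => -[[x' y'] a'] /= /eqP[-> ->].
  exact: q0.
pose w a := cond_law q (fun w => w.2) (fun w => w.1.1) a x.
have w0 a : 0 <= w a.
  by rewrite divr_ge0 ?law_ge0 // sumr_ge0 // => t _; rewrite pmf_ge0.
have w1 : \sum_a w a = 1.
  rewrite -mulr_suml /Pr -[X in X / _]/(\sum_a _).
  rewrite -[RHS](mulfV x0); congr (_ / _).
  rewrite [RHS](partition_big (fun w => w.2) xpredT) //=.
  by apply: eq_bigr => a _; apply: eq_bigl => t; rewrite andbC.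
exists (Fdist w0 w1) => y a /=.
have := qM y x a x0; rewrite -/(w a) /cond_law q1 q2 mulrAC.
by move/(divIf x0).
Qed.

End Output.

Section Code.
Variables (S B A : finType) (p : fdist R (S * B)%type).
Variables (M : nat) (hM : (0 < M)%N) (f : S -> 'I_M -> A).

(** The transition law seen once the uniform label is averaged out. *)
Definition code_channel x : fdist R A := pushforward (unif R hM) (f x).

Lemma law_code w :
  law (indep_prod p (unif R hM)) (fun w => (w.1, f w.1.1 w.2)) w =
  channel_out p code_channel w.
Proof.
case: w => s a; rewrite /law /Pr /=; under eq_bigl do rewrite /= xpair_eqE.
rewrite -(pair_big_dep (pred1 s) (fun s u => f s.1 u == a)
  (fun s u => p s * unif R hM u)) /= big_pred1_eq -mulr_sumr.
by [].
Qed.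

Lemma expect_code (Z : S * B * A -> R) :
  expect (indep_prod p (unif R hM)) (fun w => Z (w.1, f w.1.1 w.2)) =
  expect (channel_out p code_channel) Z.
Proof.
rewrite (expect_law _ (fun w => (w.1, f w.1.1 w.2)) Z).
by apply: eq_bigr => w _; rewrite law_code.
Qed.

Lemma mutual_info_code :
  mutual_info (indep_prod p (unif R hM)) (fun w => w.1.2)
    (fun w => f w.1.1 w.2) =
  mutual_info (channel_out p code_channel) (fun w => w.1.2) (fun w => w.2).
Proof.
rewrite !mutual_infoE; congr mutual; apply/funext => y; apply/funext => a.
rewrite /law !Pr_expect.
exact: (expect_code (fun w => ((w.1.2, w.2) == (y, a))%:R)).
Qed.

Lemma code_channelE x a : code_channel x a = #|[pred u | f x u == a]|%:R / M%:R.
Proof. by rewrite /= /law /Pr sumr_const mulr_natl. Qed.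

End Code.
End Channel.

(** * Simulating a channel with uniform labels *)

Section Simulation.
Variable R : realType.

(** List every [a] with multiplicity [N a], pad with [a0] up to length [M], and read the list as a
    function of the position. *)
Lemma exists_fun_of_counts (A : finType) (a0 : A) (M : nat) (N : A -> nat) :
  (\sum_a N a <= M)%N ->
  exists f : 'I_M -> A, forall a,
    #|[pred u | f u == a]| = (N a + (a == a0) * (M - \sum_b N b))%N.
Proof.
move=> NM.
pose s := flatten [seq nseq (N a) a | a <- enum A] ++
  nseq (M - \sum_b N b) a0.
have cs (P : pred A) :
    count P s = (\sum_a N a * P a + P a0 * (M - \sum_b N b))%N.
  rewrite count_cat count_flatten -map_comp sumnE big_map big_enum /=.
  rewrite count_nseq; congr addn; apply: eq_bigr => a _.
  by rewrite /= count_nseq mulnC.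
have ss : size s == M.
  rewrite -count_predT cs /= mul1n.
  by under eq_bigr do rewrite muln1; rewrite subnKC.
exists (tnth (Tuple ss)) => a.
have <- : count_mem a s = (N a + (a == a0) * (M - \sum_b N b))%N.
  rewrite cs (bigD1 a) //= eqxx muln1 big1 ?addn0 1?eq_sym // => b /negbTE ->.
  by rewrite muln0.
rewrite -[s]/(tval (Tuple ss)) -[in RHS]map_tnth_enum count_map.
by rewrite cardE -size_filter; congr size; rewrite {1}/enum_mem -enumT.
Qed.

(** Each [a] receives as many labels as the integer part of [M * V a]; [g] is the resulting rounded
    mass, and the leftover labels go to [a0]. *)
Lemma quantize (A : finType) (a0 : A) (M : nat) (hM : (0 < M)%N)
    (V : fdist R A) :
  exists (f : 'I_M -> A) (g : A -> R),
    [/\ forall a, 0 <= g a <= V a, forall a, V a <= g a + M%:R^-1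
      & forall a, law (unif R hM) f a = g a + (a == a0)%:R * (1 - \sum_b g b)].
Proof.
have M0 : 0 < M%:R :> R by rewrite ltr0n.
pose N a := Num.truncn (M%:R * V a).
have V0 a : 0 <= M%:R * V a by rewrite mulr_ge0 ?pmf_ge0 ?ltW.
have NV a : (N a)%:R <= M%:R * V a < (N a).+1%:R by exact: truncn_itv.
have NM : (\sum_a N a <= M)%N.
  rewrite -(ler_nat R) natr_sum.
  have -> : M%:R = \sum_a M%:R * V a by rewrite -mulr_sumr pmf_sum1 mulr1.
  by apply: ler_sum => a _; case/andP: (NV a).
have [f fN] := exists_fun_of_counts a0 NM.
exists f, (fun a => (N a)%:R / M%:R); split => [a|a|a].
- rewrite divr_ge0 ?(ltW M0) //= ler_pdivrMr // mulrC.
  by case/andP: (NV a).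
- rewrite -{2}[M%:R^-1]mul1r -mulrDl natr1 ler_pdivlMr // mulrC ltW //.
  by case/andP: (NV a).
- rewrite /law /Pr sumr_const /= fN -[LHS]mulr_natl natrD natrM natrB //.
  by rewrite natr_sum -mulr_suml mulrDl -mulrA mulrBl mulfV ?gt_eqF.
Qed.

Lemma simulate (S B A : finType) (p : fdist R (S * B)%type) (W : S -> fdist R A)
    (a0 : A) (M : nat) (hM : (0 < M)%N) : (0 < #|B|)%N ->
  let q := channel_out p W in
  exists (f : S -> 'I_M -> A) (theta : R),
    let q' := channel_out p (code_channel R hM f) in
    [/\ forall tau, 0 <= tau ->
          theta <= tau / M%:R + Pr q [pred w | W w.1.1 w.2 * tau < 1],
        mutual_info q' (fun w => w.1.2) (fun w => w.2) <=
          mutual_info q (fun w => w.1.2) (fun w => w.2) +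
          (2 * ln 2 + theta * ln #|B|%:R)
      & forall (c : S * B * A -> R) K, (forall w, 0 <= c w <= K) ->
          expect q' c <= expect q c + theta * K].
Proof.
move=> B0 q.
have /choice[fg fgP] : forall x, exists fg : ('I_M -> A) * (A -> R),
    [/\ forall a, 0 <= fg.2 a <= W x a,
        forall a, W x a <= fg.2 a + M%:R^-1
      & forall a, law (unif R hM) fg.1 a =
          fg.2 a + (a == a0)%:R * (1 - \sum_b fg.2 b)].
  by move=> x; have [f [g fg]] := quantize a0 hM (W x); exists (f, g).
pose f x := (fg x).1; pose g x := (fg x).2.
have g0 x a : 0 <= g x a by case: (fgP x) => /(_ a)/andP[].
have gW x a : g x a <= W x a by case: (fgP x) => /(_ a)/andP[].
have Wg x a : W x a <= g x a + M%:R^-1 by case: (fgP x) => _ /(_ a).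
pose r x := 1 - \sum_a g x a.
have rE x : r x = \sum_a (W x a - g x a) by rewrite sumrB pmf_sum1.
have r0 x : 0 <= r x by rewrite rE sumr_ge0 // => a _; rewrite subr_ge0.
have fE x a : code_channel R hM f x a = g x a + (a == a0)%:R * r x.
  by case: (fgP x) => _ _ h; exact: (h a).
have delta1 : \sum_a (a == a0)%:R = 1 :> R.
  by rewrite (bigD1 a0) //= eqxx big1 ?addr0 // => a /negbTE ->.
(* The average mass lost by rounding and moved to [a0]. *)
pose theta := \sum_s p s * r s.1.
exists f, theta => q'; split.
- move=> tau tau0.
  have -> : theta = \sum_(w : S * B * A) p w.1 * (W w.1.1 w.2 - g w.1.1 w.2).
    rewrite -(pair_bigA _ (fun s a => p s * (W s.1 a - g s.1 a))) /=.
    by apply: eq_bigr => s _; rewrite -mulr_sumr rE.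
  have -> : tau / M%:R = \sum_w q w * (tau / M%:R).
    by rewrite -mulr_suml pmf_sum1 mul1r.
  rewrite /Pr [X in _ + X]big_mkcond -big_split ler_sum //= => w _.
  have qw : 0 <= p w.1 * W w.1.1 w.2 by exact: (pmf_ge0 q).
  have tM : 0 <= tau / M%:R by rewrite divr_ge0.
  (* If [W * tau < 1], the loss [W - g] is at most [W], charged to the probability term. Otherwise
     it is at most [1 / M <= W * tau / M], and these sum to at most [tau / M]. *)
  case: ltP => h.
    rewrite ler_wpDl ?(mulr_ge0 qw tM) //.
    by rewrite ler_wpM2l ?pmf_ge0 // gerBl.
  rewrite addr0 -mulrA ler_wpM2l ?pmf_ge0 // mulrA.
  apply: (@le_trans _ _ M%:R^-1); first by rewrite lerBlDl.
  by rewrite ler_peMl ?invr_ge0.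
- rewrite !mutual_infoE.
  (* [G] is the part common to both joint laws, [b] the mass removed by rounding, [b'] the same mass
     put back on [a0]. For each [y] the last two have equal totals, as the loss depends on [x]
     only. *)
  pose G y a := \sum_x p (x, y) * g x a.
  pose b y a := \sum_x p (x, y) * (W x a - g x a).
  pose b' y a := \sum_x p (x, y) * ((a == a0)%:R * r x).
  have -> : (fun y a => law q' (fun w => (w.1.2, w.2)) (y, a)) =
      (fun y a => G y a + b' y a).
    apply/funext => y; apply/funext => a.
    rewrite law_channel_out_pair -big_split; apply: eq_bigr => x _.
    by rewrite fE mulrDr.
  have Gb : (fun y a => law q (fun w => (w.1.2, w.2)) (y, a)) =
      (fun y a => G y a + b y a).
    apply/funext => y; apply/funext => a.
    rewrite law_channel_out_pair -big_split; apply: eq_bigr => x _.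
    by rewrite /= -mulrDr subrKC.
  have bE y : \sum_a b y a = \sum_x p (x, y) * r x.
    rewrite exchange_big; apply: eq_bigr => x _ /=.
    by rewrite -mulr_sumr rE.
  have -> : theta = \sum_y \sum_a b y a.
    under eq_bigr do rewrite bE.
    by rewrite exchange_big pair_bigA; apply: eq_bigr => -[x y] _.
  rewrite Gb; apply: mutual_perturb => //.
  + by move=> y a; rewrite sumr_ge0 // => x _; rewrite mulr_ge0 ?pmf_ge0.
  + move=> y a; rewrite sumr_ge0 // => x _.
    by rewrite mulr_ge0 ?pmf_ge0 ?subr_ge0.
  + by move=> y a; rewrite sumr_ge0 // => x _; rewrite !mulr_ge0 ?pmf_ge0.
  + move=> y; rewrite bE exchange_big; apply: eq_bigr => x _ /=.
    by rewrite -mulr_sumr -mulr_suml delta1 mul1r.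
  + rewrite -(law_sum1 q (fun w => (w.1.2, w.2))) pair_bigA /=.
    apply: eq_bigr => -[y a] _ /=.
    by rewrite -[LHS]/((fun y a => G y a + b y a) y a) -Gb.
- move=> c K cK.
  have -> : theta * K =
      \sum_(w : S * B * A) p w.1 * ((w.2 == a0)%:R * r w.1.1) * K.
    rewrite -mulr_suml; congr (_ * _).
    rewrite -(pair_bigA _ (fun s a => p s * ((a == a0)%:R * r s.1))) /=.
    by apply: eq_bigr => s _; rewrite -mulr_sumr -mulr_suml delta1 mul1r.
  rewrite -big_split ler_sum //= => w _.
  case/andP: (cK w) => c0 cKw.
  have -> : law (unif R hM) (f w.1.1) w.2 =
      g w.1.1 w.2 + (w.2 == a0)%:R * r w.1.1.
    exact: fE.
  rewrite mulrDr mulrDl lerD //.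
    by rewrite ler_wpM2r // ler_wpM2l ?pmf_ge0.
  by rewrite ler_wpM2l // !mulr_ge0 ?pmf_ge0.
Qed.

End Simulation.

(** * Limits superior and the diagonal argument *)

Section Limsup.
Variable R : realType.
Implicit Types (u v : nat -> R) (l : R).

(** The upper limit is an infimum of suprema over eventual sets, so any such set for [v] may be cut
    down to the indices where the inequality holds. *)
Lemma limsup_real_le u v :
    (forall e, 0 < e -> \forall n \near \oo, u n <= v n + e) ->
  (limsup_real u <= limsup_real v)%E.
Proof.
move=> uv; apply/lee_addgt0Pr => e e0.
rewrite -leeBlDr //; apply: le_ereal_inf_tmp => _ [A nA <-].
rewrite leeBlDr //; apply: (@le_trans _ _ (ereal_sup
    [set (u n)%:E | n in A `&` [set n | u n <= v n + e]])).
  by apply: ereal_inf_lbound; exists (A `&` [set n | u n <= v n + e]) => //;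
    apply: filterI => //; exact: uv.
apply: ge_ereal_sup => _ [n [An /= uvn] <-].
apply: (@le_trans _ _ ((v n)%:E + e%:E)%E); first by rewrite -EFinD lee_fin.
by rewrite leeD2r //; apply: ereal_sup_ubound; exists n.
Qed.

Lemma limsup_real_le_cst u l :
    (forall e, 0 < e -> \forall n \near \oo, u n <= l + e) ->
  (limsup_real u <= l%:E)%E.
Proof.
move=> /(@limsup_real_le u (fun=> l))/le_trans; apply.
apply: (@le_trans _ _ (ereal_sup [set l%:E | n in [set: nat]])).
  by apply: ereal_inf_lbound; exists setT => //; exact: filterT.
by apply: ge_ereal_sup => _ [n _ <-].
Qed.

Lemma limsup_real_lt u l : (limsup_real u < l%:E)%E ->
  \forall n \near \oo, u n < l.
Proof.
move=> /ereal_inf_lt[_ [A nA <-] Al]; apply: filterS nA => n An.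
rewrite -lte_fin; apply: le_lt_trans Al.
by apply: ereal_sup_ubound; exists n.
Qed.

Lemma limsup_real_ge0 u : (forall n, 0 <= u n) -> (0 <= limsup_real u)%E.
Proof.
move=> u0; apply: le_ereal_inf_tmp => _ [A nA <-].
have [n An] := @filter_ex _ _ eventually_filter _ nA.
apply: (@le_trans _ _ (u n)%:E); first by rewrite lee_fin.
by apply: ereal_sup_ubound; exists n.
Qed.

Lemma p_limsup_le (T : nat -> finType) (p : forall n, fdist R (T n))
    (Z : forall n, T n -> R) l :
    (forall alpha, l < alpha ->
      Pr (p n) [pred t | alpha < Z n t] @[n --> \oo] --> (0 : R)) ->
  (p_limsup p Z <= l%:E)%E.
Proof.
move=> H; apply/lee_addgt0Pr => e e0; apply: ereal_inf_lbound.
by exists (l + e) => //; apply: H; rewrite ltrDl.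
Qed.

Lemma Pr_ge0 (T : finType) (p : fdist R T) (E : pred T) : 0 <= Pr p E.
Proof. by rewrite sumr_ge0 // => t _; rewrite pmf_ge0. Qed.

Lemma le_Pr (T : finType) (p : fdist R T) (E F : pred T) :
  (forall t, p t != 0 -> E t -> F t) -> Pr p E <= Pr p F.
Proof.
move=> EF; rewrite /Pr [leLHS]big_mkcond [leRHS]big_mkcond ler_sum // => t _.
have [->|pt] := eqVneq (p t) 0; first by rewrite !if_same.
by case: ifPn => [/(EF _ pt) ->//|_]; case: ifP => // _; rewrite pmf_ge0.
Qed.

(** Some admissible threshold lies below [alpha], and raising the threshold shrinks the event. *)
Lemma p_limsup_Pr_cvg0 (T : nat -> finType) (p : forall n, fdist R (T n))
    (Z : forall n, T n -> R) l alpha :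
  (p_limsup p Z <= l%:E)%E -> l < alpha ->
  Pr (p n) [pred t | alpha < Z n t] @[n --> \oo] --> (0 : R).
Proof.
move=> pl la; have : (p_limsup p Z < alpha%:E)%E.
  by rewrite (le_lt_trans pl) // lte_fin.
move=> /ereal_inf_lt[_ [b /= pb <-]]; rewrite lte_fin => ba.
apply: (@squeeze_cvgr _ _ _ _ (fun=> 0) _ _ _ 0 _ pb); last exact: cvg_cst.
apply: nearW => n; rewrite Pr_ge0 /=; apply: le_Pr => t _ /=.
exact: lt_trans.
Qed.

Lemma diagonal (th : nat -> nat -> R) :
    (forall j, th j n @[n --> \oo] --> (0 : R)) ->
  exists j : nat -> nat, forall J, \forall n \near \oo,
    (J <= j n)%N /\ th (j n) n <= J.+1%:R^-1.
Proof.
move=> th0.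
have /choice[N NP] : forall j, exists N, forall n, (N <= n)%N ->
    th j n <= j.+1%:R^-1.
  move=> j; have e0 : 0 < j.+1%:R^-1 :> R by [].
  have /cvgrPdist_le/(_ _ e0)[N _ HN] := th0 j.
  exists N => n Nn; have := HN n Nn; rewrite /= sub0r normrN.
  by apply: le_trans; exact: ler_norm.
(* The largest index [i <= n] whose bound is already valid at time [n]. Once [n] passes both [J] and
   [N J], the index [J] competes, so the maximum is attained and at least [J]. *)
exists (fun n => (\max_(i < n.+1 | N i <= n) i)%N) => J.
exists (maxn J (N J)) => // n /=; rewrite geq_max => /andP[Jn NJn].
have Jle : (J <= \max_(i < n.+1 | N i <= n) i)%N.
  have h : (J < n.+1)%N by [].
  exact: (@leq_bigmax_cond _ _ (fun i : 'I_n.+1 => i : nat) (Ordinal h)).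
split => //.
have [|i iP iE] := @eq_bigmax_cond _ [pred i : 'I_n.+1 | (N i <= n)%N]
  (fun i : 'I_n.+1 => i : nat).
  by apply/card_gt0P; exists (Ordinal (Jn : (J < n.+1)%N)).
rewrite iE in Jle *; apply: (le_trans (NP _ _ iP)).
by rewrite lef_pV2 ?posrE // ler_nat.
Qed.

Lemma cvg_expRN_natM (x : R) : 0 < x ->
  expR (- (n.+1%:R * x)) @[n --> \oo] --> (0 : R).
Proof.
move=> x0.
apply: (@squeeze_cvgr _ _ _ _ (fun=> 0) (fun n => x^-1 * n.+1%:R^-1)).
- apply: nearW => n; rewrite expR_ge0 /= expRN -invfM.
  rewrite lef_pV2 ?posrE ?expR_gt0 ?(mulr_gt0 x0) //.
  by have := expR_ge1Dx (n.+1%:R * x); lra.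
- exact: cvg_cst.
- rewrite -[0](mulr0 x^-1); apply: cvgMr; exact: cvg_harmonic.
Qed.

Lemma near_harmonic_le (C e : R) : 0 <= C -> 0 < e ->
  \forall n \near \oo, C * n.+1%:R^-1 <= e.
Proof.
move=> C0 e0; have e'0 : 0 < e / (C + 1) by rewrite divr_gt0 // ltr_wpDl.
have := near_infty_natSinv_lt (PosNum e'0); apply: filterS => n /= h.
apply: (@le_trans _ _ (C * (e / (C + 1)))); first by rewrite ler_wpM2l // ltW.
rewrite mulrCA ler_piMr ?(ltW e0) // ler_pdivrMr ?mul1r ?lerDl //.
by rewrite ltr_wpDl.
Qed.

End Limsup.

(** * Converse and achievability *)

Section Coding.
Variables (R : realType) (X Y Xhat : finType).
Variables (XY : source_pair R X Y) (c : cost_fun R X Xhat).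

Lemma converse (M : nat -> nat) (hM : forall k, (0 < M k)%N)
    (f : forall k, k.+1.-tuple X -> 'I_(M k) -> k.+1.-tuple Xhat) (rate : R) :
    (code_rate R M <= rate%:E)%E ->
  let Q k := channel_out (XY k) (code_channel R (hM k) (@f k)) in
  [/\ output_of XY Q, markov_output Q, info_rate Q = code_info XY hM f,
      (cond_sup_entropy Q <= rate%:E)%E & avg_cost c Q = code_cost XY c hM f].
Proof.
move=> Mrate Q; split.
- by move=> k s; exact: law_channel_out_fst.
- by move=> k; exact: channel_out_markov.
- congr limsup_real; apply/funext => k; congr (_ * _).
  by rewrite mutual_info_code.
- apply: p_limsup_le => alpha ra.
  have nM : \forall k \near \oo, k.+1%:R^-1 * ln (M k)%:R < alpha :> R.
    by apply: limsup_real_lt; apply: le_lt_trans Mrate _; rewrite lte_fin.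
  (* The probability is not merely small: it is eventually zero. *)
  apply: (@squeeze_cvgr _ _ _ _ (fun=> 0) (fun=> 0)); last 2 first.
  + exact: cvg_cst.
  + exact: cvg_cst.
  apply: filterS nM => k Mk; rewrite Pr_ge0 /=.
  rewrite /Pr big1 // => w /= aw; apply/eqP/negP => /negP Qw.
  move: aw; apply/negP; rewrite -leNgt; apply: le_trans (ltW Mk).
  rewrite ler_wpM2l ?invr_ge0 //.
  have [pw Ww] :=
    @channel_out_neq0 _ _ _ _ (XY k) (code_channel R (hM k) (@f k)) w Qw.
  rewrite cond_law_channel_out // div1r.
  have M0 : 0 < (M k)%:R :> R by rewrite ltr0n.
  (* [n] counts the labels producing this output. It is nonzero on the support, so the inverse
     probability [M / n] is at most [M]. *)
  move: Ww; rewrite code_channelE; set n := #|_|.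
  rewrite mulf_eq0 invr_eq0 (gt_eqF M0) orbF pnatr_eq0 -lt0n => n0.
  have n0' : 0 < n%:R :> R by rewrite ltr0n.
  rewrite ler_ln ?posrE ?invr_gt0 ?divr_gt0 // invf_div.
  by rewrite ler_pdivrMr // ler_peMr ?ler1n // ltW.
- by congr limsup_real; apply/funext => k;
    rewrite (expect_code _ _ _ (fun w => c w.1.1 w.2)).
Qed.

Lemma achievability (W : forall k, k.+1.-tuple X -> fdist R (k.+1.-tuple Xhat))
    (K rate : R) :
    (0 < #|Y|)%N -> (0 < #|Xhat|)%N ->
    (forall k x xhat, 0 <= @c k x xhat <= K) -> 0 <= rate ->
  let Q k := channel_out (XY k) (@W k) in
    (cond_sup_entropy Q <= rate%:E)%E ->
  exists (M : nat -> nat) (hM : forall k, (0 < M k)%N)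
    (f : forall k, k.+1.-tuple X -> 'I_(M k) -> k.+1.-tuple Xhat),
    [/\ (code_rate R M <= rate%:E)%E, (code_info XY hM f <= info_rate Q)%E
      & (code_cost XY c hM f <= avg_cost c Q)%E].
Proof.
move=> hY /card_gt0P[xh0 _] cK rate0 Q Qrate.
pose Z k (w : k.+1.-tuple X * k.+1.-tuple Y * k.+1.-tuple Xhat) : R :=
  k.+1%:R^-1 *
    ln (1 / cond_law (Q k) (fun v => v.2) (fun v => v.1.1) w.2 w.1.1).
(* The bound on the moved mass for slack [1 / (j + 1)]: the first term is [tau / M] when the
   exponents of [tau] and [M] differ by one slack. *)
pose th j k : R := expR (- (k.+1%:R * j.+1%:R^-1)) +
  Pr (Q k) [pred w | rate + j.+1%:R^-1 < Z k w].
have th0 j : th j n @[n --> \oo] --> (0 : R).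
  rewrite -[0](addr0 0); apply: cvgD; first by apply: cvg_expRN_natM.
  by apply: p_limsup_Pr_cvg0 Qrate _; rewrite ltrDl.
have [j jP] := diagonal th0.
pose gam k : R := (j k).+1%:R^-1.
have gam0 k : 0 < gam k by rewrite /gam.
pose x k : R := k.+1%:R * (rate + 2 * gam k).
have x0 k : 0 <= x k.
  by rewrite mulr_ge0 // addr_ge0 // mulr_ge0 // ltW.
(* An integer between [expR (x k)] and [2 * expR (x k)]; the upper bound uses [0 <= x k]. The factor
   2 costs [ln 2], negligible after division by the block length. *)
pose M k := (Num.truncn (expR (x k))).+1.
have hM k : (0 < M k)%N by [].
have Mge k : expR (x k) <= (M k)%:R.
  by have /andP[_ /ltW] := truncn_itv (expR_ge0 (x k)).
have Mle k : (M k)%:R <= 2 * expR (x k).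
  have /andP[h _] := truncn_itv (expR_ge0 (x k)).
  have := expR_ge1Dx (x k); have := x0 k.
  by rewrite /M -natr1; lra.
have Yk k : (0 < #|{: k.+1.-tuple Y}|)%N by rewrite card_tuple expn_gt0 hY.
have /all_sig[f fP] k := cid (simulate (XY k) (@W k) [tuple of nseq k.+1 xh0]
  (hM k) (Yk k)).
have {fP}/all_sig[theta fP] k := cid (fP k).
have thetaP k : theta k <= th (j k) k.
  have [/(_ (expR (k.+1%:R * (rate + gam k))) (expR_ge0 _)) h _ _] := fP k.
  apply: (le_trans h); rewrite lerD //.
    rewrite ler_pdivrMr ?ltr0n //.
    apply: le_trans (ler_wpM2l (expR_ge0 _) (Mge k)).
    by rewrite -expRD ler_expR /x -/(gam k); lra.
  (* Here [tau] is [expR (n * (rate + gam))] with [n = k.+1], so on the support [W * tau < 1] says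
     that the normalised log-likelihood exceeds [rate + gam]. *)
  apply: le_Pr => w Qw /= Wt.
  have [pw Ww] := @channel_out_neq0 _ _ _ _ (XY k) (@W k) w Qw.
  have W0 : 0 < W k w.1.1 w.2 by rewrite lt_def Ww pmf_ge0.
  rewrite /Z cond_law_channel_out // div1r mulrC ltr_pdivlMr // mulrC.
  rewrite -[ltLHS]expRK ltr_ln ?posrE ?expR_gt0 ?invr_gt0 //.
  by rewrite -[ltRHS]mul1r ltr_pdivlMr // [_ * W k _ _]mulrC.
have near_gam e : 0 < e -> \forall k \near \oo, gam k <= e /\ theta k <= e.
  move=> e0.
  have [J _ /(_ J (leqnn _)) /= Je] := near_infty_natSinv_lt (PosNum e0).
  apply: filterS (jP J) => k [Jk tk]; split; last first.
    exact: le_trans (thetaP k) (le_trans tk (ltW Je)).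
  by apply: le_trans (ltW Je); rewrite /gam lef_pV2 ?posrE // ler_nat.
have near_theta C e : 0 <= C -> 0 < e -> \forall k \near \oo, theta k * C <= e.
  move=> C0 e0; have C1 : 0 < C + 1 by rewrite ltr_wpDl.
  have e'0 : 0 < e / (C + 1) by rewrite divr_gt0.
  apply: filterS (near_gam _ e'0) => k [_ tk].
  apply: (@le_trans _ _ (e / (C + 1) * C)); first by rewrite ler_wpM2r.
  by rewrite mulrAC ler_pdivrMr // ler_pM2l // lerDl.
exists M, hM, f; split.
- apply: limsup_real_le_cst => e e0.
  have e4 : 0 < e / 4 by lra.
  have e2 : 0 < e / 2 by lra.
  apply: filterS2 (near_gam _ e4) (near_harmonic_le (ln2_ge0 R) e2).
  move=> k [gk _] lk.
  have : ln (M k)%:R <= ln 2 + x k.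
    rewrite -[x k]expRK -lnM ?posrE ?expR_gt0 //.
    by rewrite ler_ln ?posrE ?mulr_gt0 ?expR_gt0 // ltr0n.
  have k0 : 0 < k.+1%:R^-1 :> R by [].
  rewrite -(ler_pM2l k0) mulrDr /x mulKf ?pnatr_eq0 // [_ * ln 2]mulrC => h.
  apply: (le_trans h); move: (ln 2 / _) lk => a lk; lra.
- apply: limsup_real_le => e e0.
  have e2 : 0 < e / 2 by lra.
  have l2 : 0 <= 2 * ln 2 :> R by rewrite mulr_ge0 // ln2_ge0.
  have lY : 0 <= ln #|Y|%:R :> R by rewrite ln_ge0 // ler1n.
  apply: filterS2 (near_theta _ _ lY e2) (near_harmonic_le l2 e2) => k tk lk.
  have [_ + _] := fP k; rewrite mutual_info_code.
  have k0 : 0 < k.+1%:R^-1 :> R by [].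
  (* Since [ln #|Y^n|] is linear in the block length, division leaves [theta * ln #|Y|] plus a
     multiple of [1 / n]; both vanish. *)
  rewrite -(ler_pM2l k0) card_tuple natrX lnXn ?ltr0n // -[ln _ *+ _]mulr_natr.
  have -> (a t l : R) : k.+1%:R^-1 * (a + (2 * ln 2 + t * (l * k.+1%:R))) =
      k.+1%:R^-1 * a + (2 * ln 2 * k.+1%:R^-1 + t * l).
    by field; rewrite nat1r pnatr_eq0.
  by move=> h; apply: (le_trans h); rewrite lerD2l [leRHS]splitr lerD.
- apply: limsup_real_le => e e0.
  (* [|K|] still bounds the cost and is nonnegative without exhibiting a point where the cost is
     evaluated. *)
  apply: filterS (near_theta _ _ (normr_ge0 K) e0) => k tk.
  have [_ _ /(_ (fun w => @c k w.1.1 w.2) `|K|)] := fP k.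
  rewrite (expect_code _ _ _ (fun w => @c k w.1.1 w.2)) => h.
  apply: (le_trans (h _)); last by rewrite lerD2l.
  by move=> w; have /andP[-> /le_trans->] := cK _ w.1.1 w.2; rewrite ?ler_norm.
Qed.

End Coding.

(** * Equality of the operational and the information-theoretic cost *)

Theorem theorem1 (R : realType) (X Y Xhat : finType)
    (hX : (0 < #|X|)%N) (hY : (0 < #|Y|)%N) (hXhat : (0 < #|Xhat|)%N)
    (XY : source_pair R X Y) (c : cost_fun R X Xhat)
    (c_ge0 : forall k x xhat, 0 <= c k x xhat)
    (c_bounded : exists K : R, forall k x xhat, c k x xhat <= K)
    (eps rate : R) (heps : 0 <= eps) (hrate : 0 <= rate) :
  min_avg_cost XY c eps rate =
  ereal_inf [set avg_cost c Q | Q in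
    [set Q : joint_output R X Y Xhat |
      [/\ output_of XY Q,
          markov_output Q,
          (info_rate Q <= eps%:E)%E
        & (cond_sup_entropy Q <= rate%:E)%E]]].
Proof.
have [K cK] := c_bounded.
apply/eqP; rewrite eq_le; apply/andP; split; apply: le_ereal_inf_tmp.
- move=> _ [Q [QXY Qmarkov Qinfo Qrate] <-].
  have /all_sig[W QW] k := cid (markov_channel (QXY k) (Qmarkov k)).
  have {}QW : Q = fun k => channel_out (XY k) (W k).
    exact: functional_extensionality_dep.
  rewrite QW in Qinfo Qrate *.
  have c0K k x xhat : 0 <= c k x xhat <= K by rewrite c_ge0 cK.
  have [M [hM [f [Mrate finfo fcost]]]] :=
    achievability hY hXhat c0K hrate Qrate.
  (* Achievable costs are nonnegative reals, so the value minus infinity has to be excluded; for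
     plus infinity the bound is trivial. *)
  have : (0 <= avg_cost c (fun k => channel_out (XY k) (W k)))%E.
    apply: limsup_real_ge0 => k; rewrite sumr_ge0 // => w _.
    by rewrite mulr_ge0 ?pmf_ge0.
  move: fcost; case: (avg_cost _ _) => [G fcost G0|_ _|_]; last by [].
    apply: ereal_inf_lbound; exists G => //; split; first by rewrite -lee_fin.
    by exists M, hM, f; split => //; exact: le_trans Qinfo.
  exact: leey.
- move=> _ [Gamma [Gamma0 [M [hM [f [Mrate finfo fcost]]]]] <-].
  (* The channel induced by the code is a feasible output with exactly the cost of the code. *)
  have [QXY Qmarkov Qinfo Qrate Qcost] := converse XY c hM f Mrate.
  apply: le_trans fcost; rewrite -Qcost; apply: ereal_inf_lbound.
  by eexists; last reflexivity; split => //; rewrite Qinfo.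
Qed.
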